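(* Let $n$ be the number of samples at a node, $k$ the number of original features, and $T$ the number of candidate thresholds per continuous feature. For evaluating all candidate splits of the node (computing the ridge-regression losses of both children for every candidate threshold of every feature): (1) continuous regression with rank-one Cholesky updates and downdates costs $\mathcal{O}(nk^3)$; (2) binarized predicates with regression on the original $k$ features cost $\mathcal{O}(nk^3T)$; (3) fully binarized regression on $kT$ features costs $\mathcal{O}(nk^3T^3)$.
   Context: Cost counts arithmetic operations, excluding preprocessing (pre-sorting features or constructing binarized indicators). $1\le T\le n$. For a row set with design matrix $\mathbf X$ and response $\bm y$, the ridge loss is $\min_{\boldsymbol\beta}\|\mathbf X\boldsymbol\beta-\bm y\|^2+\kappa\|\boldsymbol\beta\|^2$ with $\kappa>0$. With $p$ regressors one maintains the Cholesky factor $\mathbf L$ of $\mathbf A=\mathbf X^\top\mathbf X+\kappa\mathbf I_p$ and $\bm b=\mathbf X^\top\bm y$; adding or removing one sample $\bm x$ changes $\mathbf A$ to $\mathbf A\pm\bm x\bm x^\top$, the Cholesky factor is updated/downdated in $\mathcal O(p^2)$ operations, and the ridge loss equals $\|\bm y\|^2-\|\mathbf L^{-1}\bm b\|^2$, evaluated in $\mathcal O(p^2)$ operations. The three strategies: (1) Continuous: for each of the $k$ features, sweep the (pre-sorted) samples once, moving samples one at a time from the right child to the left child with rank-one updates/downdates in dimension $k$, evaluating the loss at each candidate threshold. (2) Binarized predicates: each pair (feature, threshold) is treated as a separate binary predicate ($kT$ predicates); for each predicate the two children's ridge systems in the original $k$ regressors are built by processing all samples via rank-one updates. (3) Fully binarized: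 as in (2), but the regressors themselves are also replaced by the $kT$ binary indicator features, so each ridge system has dimension $kT$. *)

(* Defs.v *)
From HB Require Import structures.
From mathcomp Require Import all_boot all_order all_algebra.
Set Implicit Arguments.
Unset Strict Implicit.
Unset Printing Implicit Defensive.
Import Order.TTheory GRing.Theory Num.Theory.
Local Open Scope ring_scope.

(* Cost model.  A program manipulates numbers of an arbitrary type V only
   through the constructors below; since programs are written for an abstract
   V, no arithmetic can escape the count.  Comparisons of numbers are counted
   as well; loading the constant 0 and moving data are free. *)

Inductive binop := Add | Sub | Mul | Div.

Inductive prog (V A : Type) : Type :=
| Ret of A
| Zero of (V -> prog V A)
| Bin of binop & V & V & (V -> prog V A)
| Sqrt of V & (V -> prog V A)
| Leq of V & V & (bool -> prog V A).
Arguments Ret {V A}.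

Fixpoint bind (V A B : Type) (m : prog V A) (f : A -> prog V B) : prog V B :=
  match m with
  | Ret a => f a
  | Zero g => Zero (fun v => bind (g v) f)
  | Bin o x y g => Bin o x y (fun v => bind (g v) f)
  | Sqrt x g => Sqrt x (fun v => bind (g v) f)
  | Leq x y g => Leq x y (fun b => bind (g b) f)
  end.

Notation "'let!' x := m 'in' f" := (bind m (fun x => f))
  (at level 200, x binder, m at level 100, f at level 200).

Section Semantics.
Variable R : rcfType.

Definition denote (o : binop) (x y : R) : R :=
  match o with Add => x + y | Sub => x - y | Mul => x * y | Div => x / y end.

Fixpoint run (A : Type) (m : prog R A) : A :=
  match m with
  | Ret a => a
  | Zero g => run (g 0)
  | Bin o x y g => run (g (denote o x y))
  | Sqrt x g => run (g (Num.sqrt x))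
  | Leq x y g => run (g (x <= y))
  end.

Fixpoint cost (A : Type) (m : prog R A) : nat :=
  match m with
  | Ret _ => 0
  | Zero g => cost (g 0)
  | Bin o x y g => (cost (g (denote o x y))).+1
  | Sqrt x g => (cost (g (Num.sqrt x))).+1
  | Leq x y g => (cost (g (x <= y))).+1
  end.

End Semantics.

Section Programs.
Variable V : Type.

Definition zero : prog V V := Zero Ret.
Definition bin (o : binop) (x y : V) : prog V V := Bin o x y Ret.
Definition sqrt (x : V) : prog V V := Sqrt x Ret.
Definition leq_num (x y : V) : prog V bool := Leq x y Ret.

Fixpoint mapM (A B : Type) (f : A -> prog V B) (s : seq A) : prog V (seq B) :=
  if s is a :: s' then
    let! b := f a in let! t := mapM f s' in Ret (b :: t)
  else Ret [::].

Fixpoint foldM (A W : Type) (f : W -> A -> prog V W) (w : W) (s : seq A) :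
    prog V W :=
  if s is a :: s' then let! w' := f w a in foldM f w' s' else Ret w.

(* [axpy o a x y] is the vector y + a x (o = Add) or y - a x (o = Sub). *)
Definition axpy (o : binop) (a : V) (x y : seq V) : prog V (seq V) :=
  mapM (fun u => let! v := bin Mul a u.1 in bin o u.2 v) (zip x y).

(* A lower triangular p x p matrix L is stored by columns, each one starting
   at its diagonal entry: the i-th list has length p - i. *)

(* Rank-one update (o = Add) or downdate (o = Sub): the factor of
   L L^T + x x^T or L L^T - x x^T.  With first column (d, l) of L and
   x = (x0, xs), put d' = sqrt (d^2 +- x0^2), c = d' / d and s = x0 / d; the
   new first column is (d', l') with l' = (l +- s xs) / c, and the remaining
   columns are updated recursively with the vector c xs - s l'. *)
Fixpoint chol_rank1 (o : binop) (L : seq (seq V)) (x : seq V) :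
    prog V (seq (seq V)) :=
  match L, x with
  | (d :: l) :: L', x0 :: xs =>
      let! d2 := bin Mul d d in
      let! x2 := bin Mul x0 x0 in
      let! e := bin o d2 x2 in
      let! d' := sqrt e in
      let! c := bin Div d' d in
      let! s := bin Div x0 d in
      let! w := axpy o s xs l in
      let! l' := mapM (fun v => bin Div v c) w in
      let! cx := mapM (bin Mul c) xs in
      let! xs' := axpy Sub s l' cx in
      let! M := chol_rank1 o L' xs' in
      Ret ((d' :: l') :: M)
  | _, _ => Ret [::]
  end.

(* The value a - |L^-1 b|^2, by forward substitution. *)
Fixpoint sub_solve_norm (L : seq (seq V)) (b : seq V) (a : V) : prog V V :=
  match L, b with
  | (d :: l) :: L', b0 :: bs =>
      let! z := bin Div b0 d in
      let! z2 := bin Mul z z in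
      let! a' := bin Sub a z2 in
      let! bs' := axpy Sub z l bs in
      sub_solve_norm L' bs' a'
  | _, _ => Ret a
  end.

(* The ridge system of a row set: the Cholesky factor of X^T X + kappa I,
   the vector X^T y and the scalar |y|^2. *)
Record system := System { factor : seq (seq V); rhs : seq V; sqnorm : V }.

Definition empty_system (p : nat) (kappa : V) : prog V system :=
  let! z := zero in
  let! d := sqrt kappa in
  Ret (System [seq d :: nseq m z | m <- rev (iota 0 p)] (nseq p z) z).

(* Adds (o = Add) or removes (o = Sub) the sample with regressors x and
   response yi. *)
Definition move_sample (o : binop) (sys : system) (x : seq V) (yi : V) :
    prog V system :=
  let! L := chol_rank1 o (factor sys) x in
  let! b := axpy o yi x (rhs sys) in
  let! y2 := bin Mul yi yi in
  let! a := bin o (sqnorm sys) y2 in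
  Ret (System L b a).

Definition system_loss (sys : system) : prog V V :=
  sub_solve_norm (factor sys) (rhs sys) (sqnorm sys).

Section Data.
Variables (n p : nat) (kappa : V) (D : 'M[V]_(n, p)) (y : 'cV[V]_n).

Definition regressors (i : 'I_n) : seq V := [seq D i j | j <- enum 'I_p].

Definition move (o : binop) (sys : system) (i : 'I_n) : prog V system :=
  move_sample o sys (regressors i) (y i 0).

(* Strategy with one predicate per pair q of a feature and a threshold.  The
   indicator [B q i] tells whether sample i goes to the left child; for each
   q all samples are processed by rank-one updates. *)
Definition predicate_losses (Q : Type) (B : Q -> 'I_n -> bool) (q : Q) :
    prog V (Q * (V * V)) :=
  let! s0 := empty_system p kappa in
  let! sys := foldM (fun sys i =>
        if B q i then let! l := move Add sys.1 i in Ret (l, sys.2)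
        else let! r := move Add sys.2 i in Ret (sys.1, r))
      (s0, s0) (enum 'I_n) in
  let! l := system_loss sys.1 in
  let! r := system_loss sys.2 in
  Ret (q, (l, r)).

Definition predicate_strategy (k T : nat) (B : 'I_k * 'I_T -> 'I_n -> bool) :
    prog V (seq ('I_k * 'I_T * (V * V))) :=
  mapM (predicate_losses B) (enum {: 'I_k * 'I_T}).

End Data.

Section Continuous.
Variables (n k T : nat) (kappa : V).
Variables (X : 'M[V]_(n, k)) (y : 'cV[V]_n) (theta : 'M[V]_(k, T)).

(* Moves from the right to the left child the leading samples of s whose j-th
   feature is at most th; returns the remaining samples and the two systems. *)
Fixpoint advance (j : 'I_k) (th : V) (s : seq 'I_n) (l r : system) :
    prog V (seq 'I_n * (system * system)) :=
  if s is i :: s' then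
    let! le := leq_num (X i j) th in
    if le then
      let! l' := move X y Add l i in
      let! r' := move X y Sub r i in
      advance j th s' l' r'
    else Ret (s, (l, r))
  else Ret (s, (l, r)).

Fixpoint sweep (j : 'I_k) (ts : seq 'I_T) (s : seq 'I_n) (l r : system) :
    prog V (seq ('I_k * 'I_T * (V * V))) :=
  if ts is t :: ts' then
    let! st := advance j (theta j t) s l r in
    let! a := system_loss st.2.1 in
    let! b := system_loss st.2.2 in
    let! out := sweep j ts' st.1 st.2.1 st.2.2 in
    Ret ((j, t, (a, b)) :: out)
  else Ret [::].

(* [samples j] and [thresholds j] list the samples and the thresholds sorted
   along feature j.  The system of the whole node, from which the right child
   starts, is rebuilt for every feature. *)
Definition continuous_strategy (samples : 'I_k -> seq 'I_n)
    (thresholds : 'I_k -> seq 'I_T) : prog V (seq ('I_k * 'I_T * (V * V))) :=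
  let! out := mapM (fun j =>
      let! l := empty_system k kappa in
      let! r := foldM (move X y Add) l (enum 'I_n) in
      sweep j (thresholds j) (samples j) l r) (enum 'I_k) in
  Ret (flatten out).

End Continuous.
End Programs.

Section Splits.
Variables (R : rcfType) (n k T : nat).
Variables (X : 'M[R]_(n, k)) (y : 'cV[R]_n) (theta : 'M[R]_(k, T)).

(* Preprocessing, not charged. *)
Definition sorted_samples (j : 'I_k) : seq 'I_n :=
  sort (fun i i' => X i j <= X i' j) (enum 'I_n).

Definition sorted_thresholds (j : 'I_k) : seq 'I_T :=
  sort (fun t t' => theta j t <= theta j t') (enum 'I_T).

Definition indicator (q : 'I_k * 'I_T) (i : 'I_n) : bool :=
  X i q.1 <= theta q.1 q.2.

(* The n x (k T) design matrix of all the indicators as numbers 0 and 1. *)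
Definition binarized_features : 'M[R]_(n, k * T) :=
  \matrix_i mxvec (\matrix_(j, t) (indicator (j, t) i)%:R).

Definition left_child (q : 'I_k * 'I_T) : {set 'I_n} :=
  [set i | X i q.1 <= theta q.1 q.2].

Definition right_child (q : 'I_k * 'I_T) : {set 'I_n} := ~: left_child q.

Definition ridge_objective (p : nat) (kappa : R) (D : 'M[R]_(n, p))
    (S : {set 'I_n}) (beta : 'cV[R]_p) : R :=
  \sum_(i in S) ((D *m beta) i 0 - y i 0) ^+ 2
  + kappa * \sum_j beta j 0 ^+ 2.

(* l = min_beta |D_S beta - y_S|^2 + kappa |beta|^2 *)
Definition is_ridge_loss (p : nat) (kappa : R) (D : 'M[R]_(n, p))
    (S : {set 'I_n}) (l : R) : Prop :=
  (exists beta, ridge_objective kappa D S beta = l) /\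
  (forall beta, l <= ridge_objective kappa D S beta).

(* out gives, exactly once for each candidate split, the ridge losses of the
   left and of the right child for the regressors in the columns of D. *)
Definition evaluates_splits (p : nat) (kappa : R) (D : 'M[R]_(n, p))
    (out : seq ('I_k * 'I_T * (R * R))) : Prop :=
  perm_eq [seq o.1 | o <- out] (enum {: 'I_k * 'I_T}) /\
  (forall q l r, (q, (l, r)) \in out ->
     is_ridge_loss kappa D (left_child q) l /\
     is_ridge_loss kappa D (right_child q) r).

End Splits.

Section Strategies.
Variables (R : rcfType) (n k T : nat) (kappa : R).
Variables (X : 'M[R]_(n, k)) (y : 'cV[R]_n) (theta : 'M[R]_(k, T)).

Definition continuous : prog R (seq ('I_k * 'I_T * (R * R))) :=
  continuous_strategy kappa X y theta
    (sorted_samples X) (sorted_thresholds theta).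

Definition binarized : prog R (seq ('I_k * 'I_T * (R * R))) :=
  predicate_strategy kappa X y (indicator X theta).

Definition fully_binarized : prog R (seq ('I_k * 'I_T * (R * R))) :=
  predicate_strategy kappa (binarized_features X theta) y (indicator X theta).

End Strategies.

(* Main.v *)
(** A factor is used only through the quadratic form v |-> |L^T v|^2.  A
    rank-one step rotates (circularly for an update, hyperbolically for a
    downdate) the pair formed by the first column and the sample, which leaves
    |L^T v|^2 +- <x, v>^2 unchanged and eliminates the first coordinate of the
    sample; a downdate meets no nonpositive pivot because the remaining form
    is at least kappa |v|^2.  Forward substitution completes the square in
    a - 2 <b, v> + |L^T v|^2, hence computes its minimum, and this expression
    is the ridge objective as soon as the form is sum <x_i, v>^2 + kappa |v|^2.
    Since both lists are sorted, the sweep has moved exactly the left child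
    when it reaches a threshold, and a sample is moved only once per feature. *)
Require Import Defs.
From HB Require Import structures.
From mathcomp Require Import all_boot all_order all_algebra.
From mathcomp Require Import zify ring.
Import Order.TTheory GRing.Theory Num.Theory.
Local Open Scope ring_scope.
Set Implicit Arguments.
Unset Strict Implicit.
Unset Printing Implicit Defensive.

(** * Results and costs of the program combinators *)

Section Semantics.
Variable R : rcfType.

Lemma run_bind (A B : Type) (m : prog R A) (f : A -> prog R B) :
  run (bind m f) = run (f (run m)).
Proof. by elim: m => //= *. Qed.

Lemma cost_bind (A B : Type) (m : prog R A) (f : A -> prog R B) :
  cost (bind m f) = (cost m + cost (f (run m)))%N.
Proof. by elim: m => //= [o x y g IH|x g IH|x y g IH]; rewrite IH addSn. Qed.

Lemma run_mapM (A B : Type) (f : A -> prog R B) s :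
  run (mapM f s) = [seq run (f a) | a <- s].
Proof. by elim: s => //= a s IH; rewrite !run_bind IH. Qed.

Lemma cost_mapM (A B : Type) (f : A -> prog R B) s :
  cost (mapM f s) = \sum_(a <- s) cost (f a).
Proof.
by elim: s => [|a s IH]; rewrite ?big_nil //= big_cons !cost_bind IH /= addn0.
Qed.

Lemma cost_mapM_le (A B : Type) (f : A -> prog R B) c s :
  (forall a, cost (f a) <= c)%N -> (cost (mapM f s) <= size s * c)%N.
Proof.
move=> fc; rewrite cost_mapM.
by elim: s => [|a s IH]; rewrite ?big_nil // big_cons mulSn leq_add.
Qed.

Lemma run_foldM (A W : Type) (f : W -> A -> prog R W) w s :
  run (foldM f w s) = foldl (fun w a => run (f w a)) w s.
Proof. by elim: s w => //= a s IH w; rewrite run_bind IH. Qed.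

(** The cost of a step depends on the sizes held in the current state, so the uniform bound [c] is
    only available under an invariant [P] carried along the fold. *)
Lemma cost_foldM_le (A W : Type) (P : W -> Prop) (f : W -> A -> prog R W) c w s :
  (forall w a, P w -> P (run (f w a)) /\ (cost (f w a) <= c)%N) ->
  P w -> P (run (foldM f w s)) /\ (cost (foldM f w s) <= size s * c)%N.
Proof.
move=> fP; elim: s w => [|a s IH] w Pw //=.
have [Pfw cfw] := fP w a Pw; have [] := IH _ Pfw.
by rewrite run_bind cost_bind mulSn => ? ?; split=> //; rewrite leq_add.
Qed.

Lemma run_axpy o (a : R) x y :
  run (axpy o a x y) = [seq denote o u.2 (a * u.1) | u <- zip x y].
Proof. by rewrite run_mapM; apply: eq_map => u. Qed.

Lemma size_axpy o (a : R) x y :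
  size (run (axpy o a x y)) = minn (size x) (size y).
Proof. by rewrite run_axpy size_map size_zip. Qed.

Lemma cost_axpy o (a : R) x y :
  cost (axpy o a x y) = (2 * minn (size x) (size y))%N.
Proof.
rewrite cost_mapM -size_zip.
by elim: zip => [|u s IH]; rewrite ?big_nil // big_cons IH /=; lia.
Qed.

Lemma run_mapM_bin o (c : R) s :
  run (mapM (bin o c) s) = [seq denote o c v | v <- s].
Proof. by rewrite run_mapM; apply: eq_map. Qed.

Lemma run_mapM_binr o (c : R) s :
  run (mapM (fun v => bin o v c) s) = [seq denote o v c | v <- s].
Proof. by rewrite run_mapM; apply: eq_map. Qed.

(** * Quadratic operation counts for the factor routines *)

Lemma cost_chol_rank1 o (L : seq (seq R)) x :
  (cost (chol_rank1 o L x) <= 6 * size x ^ 2)%N.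
Proof.
elim: L x => [|[|d l] L IH] [|x0 xs] //=.
(* With m = [size xs], one column takes 6 scalar operations and at most 2m + m + m + 2m list
   operations, and 6 + 6m + 6m^2 <= 6(m + 1)^2. Zipping truncates, so [size x] alone controls the
   cost, whatever the shape of [L]. *)
rewrite !(cost_bind, run_bind) /=.
set c := Num.sqrt _ / d; set s := x0 / d; set w := run (axpy o s xs l).
set l' := run (mapM _ w); set cx := run (mapM _ xs).
set xs' := run (axpy Defs.Sub _ _ _).
have sw : (size w <= size xs)%N by rewrite size_axpy geq_minl.
have sl' : size l' = size w by rewrite /l' run_mapM size_map.
have scx : size cx = size xs by rewrite /cx run_mapM size_map.
have sxs' : (size xs' <= size xs)%N by rewrite size_axpy scx geq_minr.
have := IH xs'.
have c1 : (cost (mapM (fun v => bin Div v c) w) <= size w * 1)%N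
  by apply: cost_mapM_le.
have c2 : (cost (mapM (bin Mul c) xs) <= size xs * 1)%N by apply: cost_mapM_le.
have := leq_sqr (size xs') (size xs); rewrite sxs' !cost_axpy scx sl'.
rewrite -!mulnn.
move: (size xs) (size w) (size l) (size xs') (cost _) (cost _) (cost _) sw sxs' c1 c2.
by clear; lia.
Qed.

Lemma cost_sub_solve_norm (L : seq (seq R)) b a :
  (cost (sub_solve_norm L b a) <= 3 * size b ^ 2)%N.
Proof.
elim: L b a => [|[|d l] L IH] [|b0 bs] a //=.
(* One column takes 3 + 2m operations for m = [size bs], and 3 + 2m + 3m^2 <= 3(m + 1)^2. *)
rewrite !(cost_bind, run_bind) /=.
set z := b0 / d; set bs' := run (axpy Defs.Sub z l bs).
have sbs' : (size bs' <= size bs)%N by rewrite size_axpy geq_minr.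
have := IH bs' (a - z * z).
have := leq_sqr (size bs') (size bs); rewrite sbs' cost_axpy.
clearbody bs'; rewrite -!mulnn; lia.
Qed.

(** * Inner products of lists *)

Definition dot (x v : seq R) : R := \sum_(u <- zip x v) u.1 * u.2.

Lemma dot_cons a x b v : dot (a :: x) (b :: v) = a * b + dot x v.
Proof. by rewrite /dot /= big_cons. Qed.

Lemma dot_nil v : dot [::] v = 0.
Proof. by rewrite /dot /=; case: v => *; rewrite big_nil. Qed.

Lemma dot_nil_r x : dot x [::] = 0.
Proof. by rewrite /dot /=; case: x => *; rewrite big_nil. Qed.

Lemma dot_nseq0 m v : dot (nseq m 0) v = 0.
Proof.
by elim: m v => [|m IH] [|a v] //=; rewrite ?dot_nil ?dot_nil_r ?dot_cons ?IH //; ring.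
Qed.

Lemma dot_nseq0_r m v : dot v (nseq m 0) = 0.
Proof.
by elim: m v => [|m IH] [|a v] //=; rewrite ?dot_nil ?dot_nil_r ?dot_cons ?IH //; ring.
Qed.

Lemma dot_map (I : Type) (f g : I -> R) s :
  dot (map f s) (map g s) = \sum_(i <- s) f i * g i.
Proof.
by elim: s => [|i s IH]; rewrite /= ?dot_nil ?big_nil // dot_cons big_cons IH.
Qed.

Lemma dot_scale c x v : dot [seq c * t | t <- x] v = c * dot x v.
Proof.
elim: x v => [|a x IH] [|b v]; rewrite ?dot_nil ?dot_nil_r ?mulr0 //=.
by rewrite !dot_cons IH; ring.
Qed.

Lemma dot_ge0 v : 0 <= dot v v.
Proof.
elim: v => [|a v IH]; rewrite ?dot_nil // dot_cons.
by rewrite addr_ge0 // -expr2 sqr_ge0.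
Qed.

Lemma dot_gt0 v : has (fun t => t != 0) v -> 0 < dot v v.
Proof.
elim: v => //= a v IH; rewrite dot_cons -expr2 => /orP[a0|/IH v0].
  by rewrite ltr_wpDr ?dot_ge0 // exprn_even_gt0.
by rewrite ltr_wpDl ?sqr_ge0.
Qed.

(** * Correctness of the rank-one step and of forward substitution *)

Definition op_sign (o : binop) (e : R) :=
  forall a b : R, denote o a b = a + e * b.

Lemma op_sign_Add : op_sign Add 1.
Proof. by move=> a b /=; ring. Qed.

Lemma op_sign_Sub : op_sign Defs.Sub (-1).
Proof. by move=> a b /=; ring. Qed.

Lemma dot_axpy o e a x y v : op_sign o e -> size x = size y ->
  dot (run (axpy o a x y)) v = dot y v + e * a * dot x v.
Proof.
move=> oe; rewrite run_axpy.
elim: x y v => [|x0 x IH] [|y0 y] [|v0 v] //=;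
  rewrite ?dot_nil ?dot_nil_r ?dot_cons; try by move=> _; ring.
by case=> sxy; rewrite IH // oe; ring.
Qed.

(* |L^T v|^2 *)
Fixpoint quad (L : seq (seq R)) (v : seq R) : R :=
  match L, v with
  | (d :: l) :: L', v0 :: vs => (d * v0 + dot l vs) ^+ 2 + quad L' vs
  | _, _ => 0
  end.

Lemma quad_nseq0 L m : quad L (nseq m 0) = 0.
Proof.
elim: L m => [|[|a t] L IH] [|m] //=.
by rewrite IH dot_nseq0_r; ring.
Qed.

Fixpoint is_factor (p : nat) (L : seq (seq R)) : bool :=
  match p, L with
  | 0, [::] => true
  | p'.+1, (d :: l) :: L' => [&& 0 < d, size l == p' & is_factor p' L']
  | _, _ => false
  end.

(** Positivity of the target form is what keeps the pivots positive. Assuming it outright lets one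
    induction serve both signs, since it passes to the trailing columns. *)
Lemma chol_rank1_correct o e p L x : op_sign o e ->
  is_factor p L -> size x = p ->
  (forall v, size v = p -> has (fun t => t != 0) v ->
     0 < quad L v + e * dot x v ^+ 2) ->
  is_factor p (run (chol_rank1 o L x)) /\
  (forall v, size v = p ->
     quad (run (chol_rank1 o L x)) v = quad L v + e * dot x v ^+ 2).
Proof.
move=> oe.
elim: p L x => [|p IH] [|[|d l] L] [|x0 xs] //=.
  by move=> _ _ _; split=> // v _; rewrite dot_nil; ring.
move=> /and3P[d0 /eqP sl fL] [sx] pd.
rewrite !run_bind /= !oe run_mapM_bin run_mapM_binr /=.
set d' := Num.sqrt _; set c := d' / d; set s := x0 / d.
set w := run (axpy o s xs l); set l' := [seq v / c | v <- w].
set cx := [seq c * v | v <- xs]; set xs' := run (axpy Defs.Sub s l' cx).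
(* The new squared pivot is the value of the target form at the first basis vector. *)
have pos : 0 < d ^+ 2 + e * x0 ^+ 2.
  have /= := pd (1 :: nseq p 0); rewrite size_nseq oner_neq0 !dot_cons /=.
  by rewrite !dot_nseq0_r quad_nseq0 !mulr1 !addr0; apply.
have d'2 : d' ^+ 2 = d ^+ 2 + e * x0 ^+ 2 by rewrite sqr_sqrtr -!expr2 ?ltW.
have d'0 : 0 < d' by rewrite sqrtr_gt0 -!expr2.
have sw : size w = p by rewrite size_axpy sx sl minnn.
have sl' : size l' = p by rewrite size_map.
have scx : size cx = p by rewrite size_map.
have sxs' : size xs' = p by rewrite size_axpy sl' scx minnn.
have dl' v : dot l' v = (dot l v + e * s * dot xs v) / c.
  rewrite /l'; under eq_map do rewrite mulrC.
  by rewrite dot_scale (dot_axpy _ _ oe) ?sx ?sl // mulrC.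
have dxs' v : dot xs' v = c * dot xs v - s * dot l' v.
  by rewrite (dot_axpy _ _ op_sign_Sub) ?sl' ?scx // dot_scale; ring.
(* Since c^2 = 1 + e s^2, the map (a, b) |-> ((a + e s b) / c, (b - s a) / c) preserves a^2 + e b^2;
   it sends the pair of leading coefficients (d, x0) to (d', 0). *)
have key v0 vs : (d * v0 + dot l vs) ^+ 2 + e * (x0 * v0 + dot xs vs) ^+ 2 =
    (d' * v0 + dot l' vs) ^+ 2 + e * dot xs' vs ^+ 2.
  rewrite dxs'; move: (dot l vs) (dot xs vs) (dot l' vs) (dl' vs) => a b t tE.
  have c0 : c != 0 by rewrite mulf_neq0 ?invr_eq0 ?gt_eqF.
  have c2 : c ^+ 2 = 1 + e * s ^+ 2.
    by rewrite expr_div_n d'2 /s; field; rewrite gt_eqF.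
  have ct : c * t = a + e * s * b by rewrite tE mulrC divfK.
  have d't : d' * t = d * a + e * x0 * b.
    have -> : d' = c * d by rewrite divfK ?gt_eqF.
    by rewrite mulrAC ct /s; field; rewrite gt_eqF.
  (* Grouped so that [t] enters only through [d' * t], [c * t] and (1 + e s^2) t^2 = (c t)^2, which
     are free of division by [c]. *)
  rewrite (_ : _ + e * (c * b - s * t) ^+ 2 =
    d' ^+ 2 * v0 ^+ 2 + 2 * v0 * (d' * t) + ((1 + e * s ^+ 2) * t ^+ 2
    + e * c ^+ 2 * b ^+ 2 - 2 * e * s * b * (c * t))); last by ring.
  by rewrite -c2 -(exprMn 2 c t) d'2 d't c2 ct; ring.
have [||vs sv nz|fL' qL'] := IH L xs' => //.
  (* This first coordinate annihilates the square of the new first column, so positivity of the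
     whole form becomes positivity of the trailing one at [vs]. *)
  have := pd (- (dot l' vs / d') :: vs); rewrite /= sv nz orbT dot_cons.
  move=> /(_ erefl isT); rewrite -addrA addrCA key.
  by rewrite mulrN mulrC divfK ?gt_eqF // addNr expr0n add0r.
split; first by rewrite d'0 sl' eqxx.
by case=> [|v0 vs] //= [sv]; rewrite qL' // dot_cons [RHS]addrAC key; ring.
Qed.

Lemma sub_solve_norm_correct p L b a : is_factor p L -> size b = p ->
  let r := run (sub_solve_norm L b a) in
  (exists2 v, size v = p & a - 2 * dot b v + quad L v = r) /\
  (forall v, size v = p -> r <= a - 2 * dot b v + quad L v).
Proof.
elim: p L b a => [|p IH] [|[|d l] L] [|b0 bs] //= a.
  move=> _ _; split=> [|v _]; last by rewrite dot_nil mulr0 subr0 addr0.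
  by exists [::] => //; rewrite dot_nil mulr0 subr0 addr0.
move=> /and3P[d0 /eqP sl fL] [sb]; rewrite !run_bind /=.
set z := b0 / d; set bs' := run (axpy _ _ _ _); set r := run _.
have sbs' : size bs' = p by rewrite size_axpy sl sb minnn.
have dbs' v : dot bs' v = dot bs v - z * dot l v.
  by rewrite (dot_axpy _ _ op_sign_Sub) ?sl ?sb //; ring.
(* Completing the square in [v0]: the remainder has the same shape in [vs], with the data of the
   recursive call. *)
have key v0 vs : a - 2 * dot (b0 :: bs) (v0 :: vs) +
    ((d * v0 + dot l vs) ^+ 2 + quad L vs) =
    (d * v0 + dot l vs - z) ^+ 2 + (a - z * z - 2 * dot bs' vs + quad L vs).
  rewrite dot_cons dbs' (_ : b0 = z * d); first by ring.
  by rewrite /z divfK ?gt_eqF.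
have [[vs sv rE] rle] := IH L bs' (a - z * z) fL sbs'.
split=> [|[|v0 ws] //= [sw]]; last first.
  by rewrite key (le_trans (rle _ sw)) // lerDr sqr_ge0.
(* Back substitution: this first coordinate makes the completed square vanish. *)
exists ((z - dot l vs) / d :: vs); rewrite /= ?sv // key rE.
by rewrite mulrC divfK ?gt_eqF // subrK subrr expr0n add0r.
Qed.

End Semantics.

(** * Ridge systems of row sets *)

Section Systems.
Variables (R : rcfType) (n p : nat) (kappa : R).
Variables (D : 'M[R]_(n, p)) (y : 'cV[R]_n).
Hypothesis kappa_gt0 : 0 < kappa.

Let x := regressors D.

Lemma size_regressors i : size (x i) = p.
Proof. by rewrite size_map size_enum_ord. Qed.

(** The matrix and the right-hand side are known only by their values on test vectors. Rows form a
    list, so that moving a sample is a cons or its inverse. *)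
Definition represents (sys : system R) (s : seq 'I_n) : Prop :=
  [/\ is_factor p (factor sys), size (rhs sys) = p,
      forall v, size v = p -> quad (factor sys) v =
        \sum_(i <- s) dot (x i) v ^+ 2 + kappa * dot v v,
      forall v, size v = p ->
        dot (rhs sys) v = \sum_(i <- s) y i 0 * dot (x i) v &
      sqnorm sys = \sum_(i <- s) y i 0 ^+ 2].

Lemma represents_perm sys s t :
  perm_eq s t -> represents sys s -> represents sys t.
Proof.
move=> st [fL sb qL db a]; split=> // [v sv|v sv|].
- by rewrite -(perm_big _ st) qL.
- by rewrite -(perm_big _ st) db.
- by rewrite -(perm_big _ st).
Qed.

Let rev_iotaS m : rev (iota 0 m.+1) = m :: rev (iota 0 m).
Proof. by rewrite -addn1 iotaD rev_cat. Qed.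

Lemma represents_empty : represents (run (empty_system p kappa)) [::].
Proof.
split=> /= [|||v _|]; rewrite ?size_nseq ?big_nil ?dot_nseq0 //; last first.
  move=> v; rewrite big_nil add0r; elim: (p) v => [|m IH] [|v0 v] //.
    by rewrite dot_nil mulr0.
  rewrite rev_iotaS /= dot_nseq0 dot_cons => -[/IH ->].
  by rewrite addr0 exprMn sqr_sqrtr ?ltW //; ring.
elim: (p) => // m IH.
by rewrite rev_iotaS /= sqrtr_gt0 kappa_gt0 size_nseq eqxx.
Qed.

(** Relating [s] and [t] by sums covers addition and removal together. The form of [t] is a sum of
    squares plus kappa |v|^2, which gives the positivity required by the rank-one step. *)
Lemma represents_move o e sys s t i : op_sign o e -> represents sys s ->
  (forall f : 'I_n -> R, \sum_(i <- t) f i = \sum_(i <- s) f i + e * f i) ->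
  represents (run (move D y o sys i)) t.
Proof.
move=> oe [fL sb qL db a] st.
have [v sv nz|fL' qL'] := chol_rank1_correct oe fL (size_regressors i).
  rewrite qL // addrAC -st ltr_wpDl ?mulr_gt0 ?dot_gt0 //.
  by apply: sumr_ge0 => j _; rewrite sqr_ge0.
rewrite /move /move_sample !run_bind; split=> //=.
- by rewrite size_axpy size_regressors sb minnn.
- by move=> v sv; rewrite qL' // qL // st addrAC.
- by move=> v sv; rewrite (dot_axpy _ _ oe) ?size_regressors // db // st mulrA.
- by rewrite oe a st expr2.
Qed.

Lemma represents_add sys s i :
  represents sys s -> represents (run (move D y Add sys i)) (i :: s).
Proof.
move=> rs; apply: represents_move (@op_sign_Add R) rs _ => f.
by rewrite big_cons mul1r addrC.
Qed.

Lemma represents_remove sys s i :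
  represents sys (i :: s) -> represents (run (move D y Defs.Sub sys i)) s.
Proof.
move=> rs; apply: represents_move (@op_sign_Sub R) rs _ => f.
by rewrite big_cons; ring.
Qed.

Lemma dot_regressors i (beta : 'cV[R]_p) :
  dot (x i) [seq beta j 0 | j <- enum 'I_p] = (D *m beta) i 0.
Proof. by rewrite dot_map big_enum mxE. Qed.

Lemma ridge_objectiveE sys s (S : {set 'I_n}) (beta : 'cV[R]_p) :
  represents sys s -> perm_eq s (enum S) ->
  let v := [seq beta j 0 | j <- enum 'I_p] in
  ridge_objective y kappa D S beta =
    sqnorm sys - 2 * dot (rhs sys) v + quad (factor sys) v.
Proof.
move=> [fL sb qL db a] sS v.
have sv : size v = p by rewrite size_map size_enum_ord.
rewrite qL // db // a /ridge_objective !(perm_big _ sS) /= !big_enum /=.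
rewrite addrA; congr (_ + kappa * _).
  rewrite mulr_sumr -sumrB -big_split /=.
  by apply: eq_bigr => i _; rewrite dot_regressors; ring.
by rewrite dot_map big_enum; apply: eq_bigr => j _; rewrite expr2.
Qed.

Lemma system_loss_correct sys s (S : {set 'I_n}) :
  represents sys s -> perm_eq s (enum S) ->
  is_ridge_loss y kappa D S (run (system_loss sys)).
Proof.
move=> rs sS; have [fL sb _ _ _] := rs.
have [[v sv vE] le_v] := sub_solve_norm_correct (sqnorm sys) fL sb.
split=> [|beta]; last first.
  by rewrite (ridge_objectiveE _ rs sS) le_v // size_map size_enum_ord.
(* The minimizing list, turned into a column; its length is [p], so the default value of [nth] never
   occurs. *)
exists (\col_j v`_j); rewrite (ridge_objectiveE _ rs sS) -vE.
suff -> : [seq (\col_j v`_j) j 0 | j : 'I_p <- enum 'I_p] = v by [].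
under eq_map do rewrite mxE.
by rewrite -[RHS](mkseq_nth 0) sv /mkseq -val_enum_ord -map_comp.
Qed.

Lemma size_rhs_move o sys i : size (rhs sys) = p ->
  size (rhs (run (move D y o sys i))) = p.
Proof.
by move=> sb; rewrite !run_bind /= size_axpy size_regressors sb minnn.
Qed.

(** The total is at most 6p^2 for the factor, 2p for the right-hand side and 2 for the squared
    norm. *)
Lemma cost_move o sys i : (0 < p)%N -> size (rhs sys) = p ->
  (cost (move D y o sys i) <= 10 * p ^ 2)%N.
Proof.
move=> p0 sb; rewrite /move /move_sample !(cost_bind, run_bind) /= cost_axpy.
have := cost_chol_rank1 o (factor sys) (x i).
rewrite sb !size_regressors minnn; move: (cost _) => c.
by clear -p0; nia.
Qed.

Lemma cost_system_loss (sys : system R) : size (rhs sys) = p ->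
  (cost (system_loss sys) <= 3 * p ^ 2)%N.
Proof. by move=> <-; apply: cost_sub_solve_norm. Qed.

Lemma predicate_losses_correct (Q : Type) (B : Q -> 'I_n -> bool) q :
  let out := run (predicate_losses kappa D y B q) in
  [/\ out.1 = q, is_ridge_loss y kappa D [set i | B q i] out.2.1 &
      is_ridge_loss y kappa D (~: [set i | B q i]) out.2.2].
Proof.
rewrite /predicate_losses !run_bind run_foldM /=; set sys := foldl _ _ _.
(* Samples are consed as they are processed, hence the reversal. *)
have [rl rr] : represents sys.1 [seq i <- rev (enum 'I_n) | B q i] /\
    represents sys.2 [seq i <- rev (enum 'I_n) | ~~ B q i].
  rewrite {}/sys; have := represents_empty; rewrite run_bind => re.
  elim/last_ind: (enum 'I_n) => [|s i [IHl IHr]] //.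
  rewrite foldl_rcons rev_rcons /=.
  by case: (B q i); rewrite run_bind; split=> //; apply: represents_add.
split=> //.
  apply: system_loss_correct rl _.
  rewrite filter_rev perm_rev uniq_perm ?filter_uniq -?enumT ?enum_uniq // => i.
  by rewrite mem_filter !mem_enum !inE andbT.
apply: system_loss_correct rr _.
rewrite filter_rev perm_rev uniq_perm ?filter_uniq -?enumT ?enum_uniq // => i.
by rewrite mem_filter !mem_enum !inE andbT.
Qed.

(** One square root, [n] moves and two losses: 1 + 10np^2 + 6p^2 <= 17np^2. *)
Lemma cost_predicate_losses (Q : Type) (B : Q -> 'I_n -> bool) q :
  (0 < p)%N -> (0 < n)%N ->
  (cost (predicate_losses kappa D y B q) <= 17 * (n * p ^ 2))%N.
Proof.
move=> p0 n0; rewrite /predicate_losses !(cost_bind, run_bind) /=.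
set f := fun (sys : system R * system R) i => _; set s0 := (_, _).
pose P (sys : system R * system R) := size (rhs sys.1) = p /\ size (rhs sys.2) = p.
have [||[sl sr] cf] := @cost_foldM_le R _ _ P f (10 * p ^ 2) s0 (enum 'I_n).
- move=> [l r] i [/= sl sr]; rewrite /f /=.
  by case: (B q i); rewrite run_bind cost_bind /= addn0; do 2?split=> //=;
    rewrite ?size_rhs_move ?cost_move.
- by split; rewrite /= size_nseq.
have := cost_system_loss sl; have := cost_system_loss sr.
by move: cf; rewrite size_enum_ord; clear -p0 n0; nia.
Qed.

End Systems.

(** * One predicate per split, with an arbitrary design matrix *)

Section PredicateStrategy.
Variables (R : rcfType) (n k p T : nat) (kappa : R).
Variables (X : 'M[R]_(n, k)) (D : 'M[R]_(n, p)) (y : 'cV[R]_n).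
Variable theta : 'M[R]_(k, T).

Lemma predicate_strategy_correct : 0 < kappa ->
  evaluates_splits X y theta kappa D
    (run (predicate_strategy kappa D y (indicator X theta))).
Proof.
move=> kappa0; rewrite /predicate_strategy run_mapM.
have lossesP := predicate_losses_correct D y kappa0 (indicator X theta).
split=> [|q l r /mapP[q' _ qE]].
  rewrite -map_comp (eq_map (g := id)) ?map_id // => q /=.
  by have [] := lossesP q.
by have [] := lossesP q'; rewrite -qE /= => <-.
Qed.

Lemma cost_predicate_strategy : (0 < p)%N -> (0 < n)%N ->
  (cost (predicate_strategy kappa D y (indicator X theta))
     <= k * T * (17 * (n * p ^ 2)))%N.
Proof.
move=> p0 n0; have <- : size (enum {: 'I_k * 'I_T}) = (k * T)%N.
  by rewrite -cardE card_prod !card_ord.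
by apply: cost_mapM_le => q; apply: cost_predicate_losses.
Qed.

End PredicateStrategy.

(** * The sorted sweep and its amortized cost *)

Section ContinuousStrategy.
Variables (R : rcfType) (n k T : nat) (kappa : R).
Variables (X : 'M[R]_(n, k)) (y : 'cV[R]_n) (theta : 'M[R]_(k, T)).

Let sorted_along j := sorted (fun i i' : 'I_n => X i j <= X i' j).

Let le_sample_trans j : transitive (fun i i' : 'I_n => X i j <= X i' j).
Proof. by move=> i1 i2 i3; apply: le_trans. Qed.

Let le_threshold_trans j : transitive (fun t t' : 'I_T => theta j t <= theta j t').
Proof. by move=> t1 t2 t3; apply: le_trans. Qed.

Lemma advance_correct j th s l r : 0 < kappa -> sorted_along j s ->
  represents kappa X y r s ->
  forall moved, represents kappa X y l moved -> all (fun i => X i j <= th) moved ->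
  let st := run (advance X y j th s l r) in
  exists moved', [/\ represents kappa X y st.2.1 moved' /\
      represents kappa X y st.2.2 st.1,
    perm_eq (moved' ++ st.1) (moved ++ s),
    all (fun i => X i j <= th) moved',
    all (fun i => ~~ (X i j <= th)) st.1 & sorted_along j st.1].
Proof.
move=> kappa0; elim: s l r => [|i s IH] l r ss rr moved rl le_moved /=.
  by exists moved.
case: ifPn => Xi /=; last first.
  (* As the samples are sorted, the first one above the threshold forces all later ones above it. *)
  exists moved; split=> //=; rewrite Xi; apply/allP => i' i's.
  move: ss => /= /(order_path_min (@le_sample_trans j))/allP/(_ _ i's) Xi'.
  by apply: contra Xi; apply: le_trans.
rewrite 2!run_bind.
have [|m [rep pm le_m gt_s ss']] := IH _ _ (path_sorted ss) (represents_remove kappa0 rr)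
  (i :: moved) (represents_add kappa0 i rl); first by rewrite /= Xi.
exists m; split=> //; apply: perm_trans pm _.
by rewrite perm_sym -cat1s perm_catCA.
Qed.

(** The invariant is that [moved] and [s] partition the samples and that [moved] lies below every
    remaining threshold; sorted thresholds preserve it. *)
Lemma sweep_correct j ts s l r moved : 0 < kappa ->
  sorted_along j s -> sorted (fun t t' => theta j t <= theta j t') ts ->
  represents kappa X y r s -> represents kappa X y l moved ->
  {in ts, forall t, all (fun i => X i j <= theta j t) moved} ->
  perm_eq (moved ++ s) (enum 'I_n) ->
  let out := run (sweep X y theta j ts s l r) in
  [seq o.1 | o <- out] = [seq (j, t) | t <- ts] /\
  {in out, forall o,
     is_ridge_loss y kappa X (left_child X theta o.1) o.2.1 /\
     is_ridge_loss y kappa X (right_child X theta o.1) o.2.2}.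
Proof.
move=> kappa0; elim: ts s l r moved => [|t ts IH] s l r moved //=.
move=> ss sts rr rl le_moved pm; rewrite !run_bind /=.
set st := run (advance _ _ _ _ _ _ _).
have [m [[rl' rr'] pm' le_m gt_s ss']] :=
  advance_correct kappa0 ss rr rl (le_moved t (mem_head _ _)).
have pm_all := perm_trans pm' pm.
have le_m' : {in ts, forall t', all (fun i => X i j <= theta j t') m}.
  move=> t' t't; apply: sub_all le_m => i /le_trans; apply.
  by have /allP/(_ _ t't) := order_path_min (@le_threshold_trans j) sts.
have [outE outP] := IH _ _ _ _ ss' (path_sorted sts) rr' rl' le_m' pm_all.
split=> [|o]; first by rewrite /= outE.
rewrite inE => /predU1P[->|/outP//] /=.
(* Every sample is in [m] or [st.1], so the one-sided bounds on these lists become equivalences. *)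
have childE i : (i \in m) = (X i j <= theta j t) /\
    (i \in st.1) = ~~ (X i j <= theta j t).
  have : i \in m ++ st.1 by rewrite (perm_mem pm_all) mem_enum.
  rewrite mem_cat => i_in; split; apply/idP/idP.
  - exact: (allP le_m).
  - by move=> Xi; case/orP: i_in => // /(allP gt_s); rewrite Xi.
  - exact: (allP gt_s).
  - by move=> Xi; case/orP: i_in => // /(allP le_m) Xi'; rewrite Xi' in Xi.
have := perm_uniq pm_all; rewrite enum_uniq cat_uniq => /and3P[um _ us].
split.
  apply: system_loss_correct rl' _ => //; apply: uniq_perm; rewrite ?enum_uniq //.
  by move=> i; rewrite mem_enum inE (childE i).1.
apply: system_loss_correct rr' _ => //; apply: uniq_perm; rewrite ?enum_uniq //.
by move=> i; rewrite mem_enum !inE (childE i).2.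
Qed.

Lemma continuous_correct : 0 < kappa ->
  evaluates_splits X y theta kappa X (run (continuous kappa X y theta)).
Proof.
move=> kappa0; rewrite /continuous /continuous_strategy run_bind run_mapM /=.
set f := fun j => run _.
have fP j : [seq o.1 | o <- f j] = [seq (j, t) | t <- sorted_thresholds theta j] /\
  {in f j, forall o,
     is_ridge_loss y kappa X (left_child X theta o.1) o.2.1 /\
     is_ridge_loss y kappa X (right_child X theta o.1) o.2.2}.
  rewrite /f !run_bind.
  apply: (sweep_correct (moved := [::])) => //.
  - by apply: sort_sorted => i i'; apply: le_total.
  - by apply: sort_sorted => t t'; apply: le_total.
  - have rep : represents kappa X y (run (foldM (move X y Add)
        (run (empty_system k kappa)) (enum 'I_n))) (rev (enum 'I_n)).
      rewrite run_foldM; elim/last_ind: (enum 'I_n) => [|s i IH].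
        exact: represents_empty.
      by rewrite foldl_rcons rev_rcons; apply: represents_add.
    by apply: represents_perm rep; rewrite perm_rev perm_sym perm_sort.
  - exact: represents_empty.
  - by rewrite /= perm_sort.
split=> [|q l r /flatten_mapP[j _ qj]]; last exact: (fP j).2 _ qj.
rewrite map_flatten -map_comp (eq_map (fun j => (fP j).1)).
apply: uniq_perm; rewrite ?enum_uniq //.
  apply: allpairs_uniq_dep => [|j _|[j t] [j' t'] _ _ [-> ->]//].
    exact: enum_uniq.
  by rewrite sort_uniq enum_uniq.
move=> [j t]; rewrite mem_enum inE; apply/allpairsPdep; exists j, t.
by rewrite mem_sort !mem_enum.
Qed.

(** A potential argument: each sample still on the right holds credit for one comparison and two
    moves, 1 + 20k^2. The final 1 pays for the comparison that stops the advance. *)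
Lemma cost_advance j th s l r : (0 < k)%N ->
  size (rhs l) = k -> size (rhs r) = k ->
  let st := run (advance X y j th s l r) in
  [/\ size (rhs st.2.1) = k, size (rhs st.2.2) = k &
      (cost (advance X y j th s l r) + size st.1 * (20 * k ^ 2).+1
         <= size s * (20 * k ^ 2).+1 + 1)%N].
Proof.
move=> k0; elim: s l r => [|i s IH] l r sl sr //=.
case: ifPn => Xi //=; last by split=> //; lia.
rewrite 2!run_bind 2!cost_bind.
have [] := IH _ _ (size_rhs_move X y Add i sl) (size_rhs_move X y Defs.Sub i sr).
have := cost_move X y Add i k0 sl; have := cost_move X y Defs.Sub i k0 sr.
move=> ? ? -> -> ?; split=> //; rewrite mulSn; lia.
Qed.

(** The credits telescope over the thresholds, so moves are paid once per sample; each threshold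
    adds two losses and one failed comparison. *)
Lemma cost_sweep j ts s l r : (0 < k)%N ->
  size (rhs l) = k -> size (rhs r) = k ->
  (cost (sweep X y theta j ts s l r)
     <= size s * (20 * k ^ 2).+1 + size ts * (6 * k ^ 2).+1)%N.
Proof.
move=> k0; elim: ts s l r => [|t ts IH] s l r sl sr //=.
rewrite !(run_bind, cost_bind) /=; set st := run _.
have [sl' sr'] := cost_advance j (theta j t) s k0 sl sr.
rewrite -/st in sl' sr' *.
have := IH st.1 _ _ sl' sr'.
have := cost_system_loss sl'; have := cost_system_loss sr'.
by rewrite mulSn; lia.
Qed.

Lemma cost_continuous : (0 < k)%N -> (0 < T <= n)%N ->
  (cost (continuous kappa X y theta) <= k * (39 * (n * k ^ 2)))%N.
Proof.
move=> k0 /andP[T0 Tn]; rewrite /continuous /continuous_strategy cost_bind addn0.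
suff: forall j, (cost (let! l := empty_system k kappa in
    let! r := foldM (move X y Add) l (enum 'I_n) in
    sweep X y theta j (sorted_thresholds theta j) (sorted_samples X j) l r)
    <= 39 * (n * k ^ 2))%N.
  by move/(cost_mapM_le (enum 'I_k)); rewrite size_enum_ord.
move=> j.
rewrite !(run_bind, cost_bind) /=.
set e := System _ _ _; have se : size (rhs e) = k by rewrite /= size_nseq.
have [|sr cf] := @cost_foldM_le R _ _ (fun sys => size (rhs sys) = k)
  (move X y Add) (10 * k ^ 2) e (enum 'I_n) _ se.
  by move=> sys i ss; rewrite size_rhs_move ?cost_move.
have := cost_sweep j (sorted_thresholds theta j) (sorted_samples X j) k0 se sr.
move: cf; rewrite !size_sort !size_enum_ord.
(* 1 + 10nk^2 + n(20k^2 + 1) + T(6k^2 + 1) <= 39nk^2, using T <= n. *)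
by nia.
Qed.

End ContinuousStrategy.

Theorem theoremA3 :
  exists C : nat,
  forall (R : rcfType) (n k T : nat) (kappa : R)
    (X : 'M[R]_(n, k)) (y : 'cV[R]_n) (theta : 'M[R]_(k, T)),
  0 < kappa -> (1 <= T <= n)%N ->
  [/\ evaluates_splits X y theta kappa X
        (run (continuous kappa X y theta)) /\
      (cost (continuous kappa X y theta) <= C * (n * k ^ 3))%N,
      evaluates_splits X y theta kappa X
        (run (binarized kappa X y theta)) /\
      (cost (binarized kappa X y theta) <= C * (n * k ^ 3 * T))%N &
      evaluates_splits X y theta kappa (binarized_features X theta)
        (run (fully_binarized kappa X y theta)) /\
      (cost (fully_binarized kappa X y theta)
         <= C * (n * k ^ 3 * T ^ 3))%N].
Proof.
exists 39%N => R n k T kappa X y theta kappa0 Tn.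
have [T0 n0] : (0 < T)%N /\ (0 < n)%N by lia.
split; split; try by [apply: continuous_correct | apply: predicate_strategy_correct].
(* The cost bounds assume a positive dimension; for [k = 0] there is no feature to loop over and the
   cost is 0. *)
all: have [k0|k0] := posnP k.
- subst k; rewrite /continuous /continuous_strategy cost_bind cost_mapM.
  by rewrite big_enum big_ord0.
- by have := cost_continuous kappa X y theta k0 Tn; rewrite expnSr; lia.
- subst k; rewrite /binarized /predicate_strategy cost_mapM big_enum.
  by rewrite big1 // => -[[]].
- apply: leq_trans (cost_predicate_strategy kappa X X y theta k0 n0) _.
  by rewrite (expnSr k 2); lia.
- subst k; rewrite /fully_binarized /predicate_strategy cost_mapM big_enum.
  by rewrite big1 // => -[[]].
have kT0 : (0 < k * T)%N by rewrite muln_gt0 k0.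
apply: leq_trans (cost_predicate_strategy kappa X _ y theta kT0 n0) _.
(* In dimension kT, the kT predicates cost 17 kT n (kT)^2 = 17 n (kT)^3. *)
by rewrite -[in leqRHS]mulnA -expnMn (expnSr _ 2); lia.
Qed.
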